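(* Let $L:\mathbb{N}\to\mathbb{N}$ and $p,q:\mathbb{N}\to\mathbb{N}\cup\{0\}$ be functions with $p(1)=q(1)=0$ chosen in one of the following three ways. (A) $f:\mathbb{N}\to\mathbb{N}$ is unbounded and nondecreasing; $L$ is nondecreasing with $L(n+1)\ge 64L(n)+29$ for all $n\in\mathbb{N}$; $p,q$ are nondecreasing with $p(n+1)\ge p(n)+q(n)+1$ and $q(n+1)\ge p(n+1)+q(n)+1$ for all $n\in\mathbb{N}$, and $(q(m)-p(m))/2\ge f(L(m+1))$ for all $m\ge 2$. (B) $f:\mathbb{N}\to\mathbb{N}$ is unbounded and nondecreasing and $M\ge2$ is an integer with $f(Mn)\ge Mf(n)$ for all $n\in\mathbb{N}$; $k\in\mathbb{N}$ satisfies $M^k\ge 9$; $T\ge M^k$ is an integer with $T^{m+1}\ge 64T^m+29$ for all $m\in\mathbb{N}$; $L(m)=T^m$ for all $m\in\mathbb{N}$; and $p(m)=f(T^{m+1})$, $q(m)=3f(T^{m+1})$ for all $m\ge2$. (C) $f:\mathbb{N}\to\mathbb{N}$ is surjective, unbounded and nondecreasing and $M\ge 2$ is an integer with $f(Mn)\le Mf(n)$ for all $n\in\mathbb{N}$; $k\in\mathbb{N}$ satisfies $M^k\ge 93$; $T$ is an integer with $T\ge (M+1)^k$ and $T\ge 9$; $L(m)=\min f^{-1}(T^m)$ for all $m\in\mathbb{N}$; and $p(m)=T^m$, $q(m)=3T^m$ for all $m\ge 2$. Then the group $\Gamma=\Gamma(L)$ constructed from $L,p,q$ as described in the context is not residually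 finite.
   Context: $\mathbb{N}=\{1,2,3,\dots\}$; $F_2$ is the free group of rank 2 with word length $|\cdot|$ for a fixed free basis. Construction of $\Gamma(L)$ from $L,p,q$: for $n\in\mathbb{N}$ let $p_n$ be the smallest prime with $L(n)<(p_n-1)/3$ (the primes $p_n$ are not to be confused with the function $p$), let $W_n=\{w\in F_2\setminus\{1\}: |w|<(p_n-1)/3\}$, and let $\Delta=\bigoplus_{n=1}^\infty \mathrm{PSL}_2(p_n)^{W_n}$, where $\mathrm{PSL}_2(p_n)^{W_n}$ is the direct power indexed by $W_n$. Choose $\bar g_n,\bar h_n\in \mathrm{PSL}_2(p_n)^{W_n}$ with $w(\bar g_n,\bar h_n)\ne e$ for all $w\in W_n$ (such elements exist), regarded as elements of the $n$-th summand of $\Delta$. Define $\hat g,\hat h:\mathbb{Z}\to\Delta$ by $\hat g(p(n))=\bar g_n$ and $\hat h(q(n))=\bar h_n$ for $n\in\mathbb{N}$, $\hat g(m)=e$ for $m\notin\mathrm{im}(p)$, $\hat h(m)=e$ for $m\notin\mathrm{im}(q)$. Let $\Delta^{\mathbb{Z}}\rtimes\mathbb{Z}$ be the unrestricted wreath product, where $\mathbb{Z}$ is generated by $t$ and acts by shifting: $\hat f^{t^n}=t^n\hat f t^{-n}$ satisfies $\hat f^{t^n}(m)=\hat f(m-n)$. Then $\Gamma(L)$ is the subgroup generated by $S(L)=\{\hat g,\hat h,t\}$. *)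

(* Defs.v *)
From HB Require Import structures.
From mathcomp Require Import all_boot all_order all_algebra all_fingroup center.
From mathcomp Require Import boolp classical_sets cardinality.

Set Implicit Arguments.
Unset Strict Implicit.
Unset Printing Implicit Defensive.

Import GRing.Theory.

Local Open Scope group_scope.
Local Open Scope classical_set_scope.

Definition residually_finite (G : groupType) : Prop :=
  forall x : G, x <> 1 ->
  exists (Q : finGroupType) (phi : {multiplicative G -> Q}), phi x <> 1.

Definition is_subgroup (G : groupType) (H : set G) : Prop :=
  [/\ H 1, forall x y, H x -> H y -> H (x * y) & forall x, H x -> H x^-1].

Lemma is_subgroup_closed (G : groupType) (H : set G) :
  is_subgroup H -> group_closed (mem H).
Proof.
move=> [H1 HM HV]; split; first by rewrite inE.
by move=> x y; rewrite !inE => Hx Hy; apply: HM => //; apply: HV.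
Qed.

Definition gen (G : groupType) (S : set G) : set G :=
  smallest (@is_subgroup G) S.

Lemma gen_subgroup (G : groupType) (S : set G) : is_subgroup (gen S).
Proof.
split=> [A [[]]//|x y Sx Sy A [sgA SA]|x Sx A [sgA SA]].
  by case: (sgA) => _ AM _; apply: AM; [apply: Sx|apply: Sy].
by case: (sgA) => _ _; apply; apply: Sx.
Qed.

Definition gen_group (G : groupType) (S : set G) : Type := set_type (gen S).
HB.instance Definition _ (G : groupType) (S : set G) :=
  SubChoice.on (gen_group S).
HB.instance Definition _ (G : groupType) (S : set G) :=
  SubChoice_isSubGroup.Build G (mem (gen S)) (gen_group S)
    (is_subgroup_closed (gen_subgroup S)).

(* Unrestricted direct product of an arbitrary family of groups. *)
Definition extprod (I : Type) (G : I -> groupType) : Type := forall i, G i.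

Section DirectProduct.
Variables (I : Type) (G : I -> groupType).
Implicit Types x y z : extprod G.

Definition extprod_one : extprod G := fun=> 1.
Definition extprod_mul x y : extprod G := fun i => x i * y i.
Definition extprod_inv x : extprod G := fun i => (x i)^-1.

Lemma extprod_mulgA : associative extprod_mul.
Proof. by move=> x y z; apply/functional_extensionality_dep=> i; apply: mulgA. Qed.
Lemma extprod_mul1g : left_id extprod_one extprod_mul.
Proof. by move=> x; apply/functional_extensionality_dep=> i; apply: mul1g. Qed.
Lemma extprod_mulg1 : right_id extprod_one extprod_mul.
Proof. by move=> x; apply/functional_extensionality_dep=> i; apply: mulg1. Qed.
Lemma extprod_mulVg : left_inverse extprod_one extprod_inv extprod_mul.
Proof. by move=> x; apply/functional_extensionality_dep=> i; apply: mulVg. Qed.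
Lemma extprod_mulgV : right_inverse extprod_one extprod_inv extprod_mul.
Proof. by move=> x; apply/functional_extensionality_dep=> i; apply: mulgV. Qed.

HB.instance Definition _ := gen_eqMixin (extprod G).
HB.instance Definition _ := gen_choiceMixin (extprod G).
HB.instance Definition _ := isGroup.Build (extprod G)
  extprod_mulgA extprod_mul1g extprod_mulg1 extprod_mulVg extprod_mulgV.

End DirectProduct.

Section DirectSum.
Variables (I : choiceType) (G : I -> groupType).

Definition finsupp_prod : set (extprod G) :=
  [set x | finite_set [set i | x i <> 1]].

Lemma finsupp_subgroup : is_subgroup finsupp_prod.
Proof.
split=> [|x y fx fy|x fx]; rewrite /finsupp_prod /=.
- by apply: (sub_finite_set _ (finite_set0 I)) => i.
- have fxy : finite_set ([set i | x i <> 1] `|` [set i | y i <> 1]).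
    by rewrite finite_setU.
  apply: sub_finite_set fxy => i /= xyi.
  have [xi|] := pselect (x i = 1); last by left.
  by right=> yi; apply: xyi; rewrite -[LHS]/(x i * y i) xi yi mulg1.
apply: sub_finite_set fx => i /= xi xi1; apply: xi.
by rewrite -[LHS]/((x i)^-1) xi1 invg1.
Qed.

Definition dsum : Type := set_type finsupp_prod.
HB.instance Definition _ := SubChoice.on dsum.
HB.instance Definition _ := SubChoice_isSubGroup.Build (extprod G)
  (mem finsupp_prod) dsum (is_subgroup_closed finsupp_subgroup).

Lemma dsum_in_subproof i (x : G i) :
  (@dfwith I G (fun=> 1) i x : extprod G) \in finsupp_prod.
Proof.
rewrite inE; apply: (sub_finite_set _ (finite_set1 i)) => j /=.
have [->//|ne_ji] := eqVneq j i; rewrite dfwith_out ?(eq_sym i) //.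
Qed.

Definition dsum_in i (x : G i) : dsum :=
  exist _ (@dfwith I G (fun=> 1) i x : extprod G) (dsum_in_subproof x).

End DirectSum.

(* Unrestricted wreath product G^Z ><| Z; Wreath f a stands for f t^a. *)
Record wreathZ (G : groupType) : Type :=
  Wreath { wbase : int -> G; wexp : int }.

Section Wreath.
Variable G : groupType.
Implicit Types (f : int -> G) (a : int) (u v w : wreathZ G).

Definition shift f a : int -> G := fun m => f (m - a)%R.

Definition wr_one : wreathZ G := Wreath (fun=> 1) 0.
Definition wr_mul u v : wreathZ G :=
  Wreath (fun m => wbase u m * shift (wbase v) (wexp u) m)
         (wexp u + wexp v)%R.
Definition wr_inv u : wreathZ G :=
  Wreath (shift (fun m => (wbase u m)^-1) (- wexp u)%R) (- wexp u)%R.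

Lemma wr_mulgA : associative wr_mul.
Proof.
move=> u v w; rewrite /wr_mul /shift /= addrA; congr Wreath.
by apply/funext=> m; rewrite mulgA opprD addrA.
Qed.
Lemma wr_mul1g : left_id wr_one wr_mul.
Proof.
move=> [f a]; rewrite /wr_mul /shift /= add0r; congr Wreath.
by apply/funext=> m; rewrite mul1g subr0.
Qed.
Lemma wr_mulg1 : right_id wr_one wr_mul.
Proof.
move=> [f a]; rewrite /wr_mul /shift /= addr0; congr Wreath.
by apply/funext=> m; rewrite mulg1.
Qed.
Lemma wr_mulVg : left_inverse wr_one wr_inv wr_mul.
Proof.
move=> [f a]; rewrite /wr_mul /shift /= addNr; congr Wreath.
by apply/funext=> m; rewrite mulVg.
Qed.
Lemma wr_mulgV : right_inverse wr_one wr_inv wr_mul.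
Proof.
move=> [f a]; rewrite /wr_mul /shift /= addrN; congr Wreath.
by apply/funext=> m; rewrite /wr_inv /shift /= opprK subrK mulgV.
Qed.

HB.instance Definition _ := gen_eqMixin (wreathZ G).
HB.instance Definition _ := gen_choiceMixin (wreathZ G).
HB.instance Definition _ := isGroup.Build (wreathZ G)
  wr_mulgA wr_mul1g wr_mulg1 wr_mulVg wr_mulgV.

Definition wr_base f : wreathZ G := Wreath f 0.
Definition wr_t : wreathZ G := Wreath (fun=> 1) 1.

Lemma wr_tX n : wr_t ^+ n = Wreath (fun=> 1) n%:Z.
Proof.
elim: n => [//|n IHn]; rewrite expgS IHn intS; congr Wreath.
by apply/funext=> m; rewrite /shift mulg1.
Qed.

Lemma wr_shift f n :
  wr_t ^+ n * wr_base f * wr_t ^- n = wr_base (shift f n%:Z).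
Proof.
rewrite wr_tX -[LHS]/(wr_mul (wr_mul _ _) (wr_inv _)) /wr_mul /wr_base /=.
rewrite addr0 addrN; congr Wreath; apply/funext=> m.
by rewrite /shift /= mul1g invg1 mulg1.
Qed.

End Wreath.

Section PSL2.
Variable p : nat.

Definition SL2 : {set {'GL_2['F_p]}} := [set A | (\det (GLval A) == 1)%R]%SET.

Lemma SL2_group_set : group_set SL2.
Proof.
apply/group_setP; split=> [|A B]; first by rewrite inE GL_1E det1.
by rewrite !inE GL_ME => /eqP dA /eqP dB; rewrite det_mulmx dA dB mulr1.
Qed.
Canonical SL2_group := Group SL2_group_set.

Definition PSL2 : finGroupType := subg_of (SL2_group / 'Z(SL2_group))%G.

End PSL2.

(* The free group of rank 2 as the set of reduced words in a, b and their
   inverses. The letter (i, s) is a if i = false and b if i = true, inverted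
   when s = true; the word length is the size of the reduced word and the
   identity is the empty word. *)
Definition letter : Type := (bool * bool)%type.
Definition letterV (l : letter) : letter := (l.1, ~~ l.2).
Definition reduced (w : seq letter) : bool :=
  sorted (fun l1 l2 : letter => l2 != letterV l1) w.
Definition F2 : Type := {w : seq letter | reduced w}.
Definition F2_one : F2 := exist _ [::] isT.
Definition F2_length (w : F2) : nat := size (val w).

Definition letter_eval (G : groupType) (g h : G) (l : letter) : G :=
  let x := if l.1 then h else g in if l.2 then x^-1 else x.
(* w(g, h): the image of w under a |-> g, b |-> h. *)
Definition F2_eval (G : groupType) (w : F2) (g h : G) : G :=
  \prod_(l <- val w) letter_eval g h l.

(* The positive integers, as an index set. Below, functions with domain the
   positive integers are functions on nat whose value at 0 is irrelevant. *)
Definition Npos : choiceType := {n : nat | 0 < n}.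

Section Construction.
Variable L : nat -> nat.

Lemma ex_prime_gt n : exists p, prime p && (3 * L n < p - 1)%N.
Proof.
have [p lt_p pr_p] := prime_above (3 * L n + 1)%N.
by exists p; rewrite pr_p ltn_subRL addnC.
Qed.

(* The smallest prime p with L n < (p - 1) / 3. *)
Definition prime_of (n : nat) : nat := ex_minn (ex_prime_gt n).

(* The words w <> 1 with |w| < (p_n - 1) / 3. *)
Definition W (n : nat) : Type :=
  {w : F2 | (w != F2_one) && (3 * F2_length w < prime_of n - 1)%N}.

Definition PSL2_power (n : nat) : groupType :=
  @extprod (W n) (fun=> PSL2 (prime_of n)).

Definition Delta : groupType :=
  @dsum Npos (fun n => PSL2_power (val n)).

Definition in_summand (n : Npos) (x : PSL2_power (val n)) : Delta :=
  @dsum_in Npos (fun k => PSL2_power (val k)) n x.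

(* The function Z -> Delta sending r n to g n, for n > 0, and every integer
   that is not of the form r n to the identity; it is used for functions r
   injective on the positive integers. *)
Definition scatter (r : nat -> nat) (g : forall n : Npos, PSL2_power (val n))
    (m : int) : Delta :=
  match pselect (exists n : Npos, Posz (r (val n)) = m) with
  | left im_m => let n := projT1 (cid im_m) in in_summand (g n)
  | right _ => 1
  end.

Lemma scatter_at r g (n : Npos) :
    injective (fun k : Npos => r (val k)) ->
  scatter r g (Posz (r (val n))) = in_summand (g n).
Proof.
move=> r_inj; rewrite /scatter; case: pselect => [im_m|[]]; last by exists n.
by case: (cid im_m) => k /= [/r_inj ->].
Qed.

Lemma scatter_out r g (m : int) :
  ~ (exists n : Npos, Posz (r (val n)) = m) -> scatter r g m = 1.
Proof. by rewrite /scatter; case: pselect. Qed.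

Definition Gamma (p q : nat -> nat)
    (gbar hbar : forall n : Npos, PSL2_power (val n)) : groupType :=
  gen_group [set wr_base (scatter p gbar); wr_base (scatter q hbar);
                 wr_t Delta].

End Construction.

Local Close Scope group_scope.
Local Close Scope classical_set_scope.

Definition pos_valued (f : nat -> nat) : Prop :=
  forall n, 0 < n -> 0 < f n.
Definition nondecr (f : nat -> nat) : Prop :=
  forall m n, 0 < m -> m <= n -> f m <= f n.
Definition unbounded (f : nat -> nat) : Prop :=
  forall B, exists2 n, 0 < n & B < f n.
Definition surj_pos (f : nat -> nat) : Prop :=
  forall y, 0 < y -> exists2 x, 0 < x & f x = y.
(* l = min f^{-1}(y) *)
Definition is_min_preim (f : nat -> nat) (y l : nat) : Prop :=
  [/\ 0 < l, f l = y & forall x, 0 < x -> f x = y -> l <= x].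

Record caseA (L p q f : nat -> nat) : Prop := CaseA {
  caseA_f_pos : pos_valued f;
  caseA_f_unb : unbounded f;
  caseA_f_mono : nondecr f;
  caseA_L_mono : nondecr L;
  caseA_L_growth : forall n, 0 < n -> L n.+1 >= 64 * L n + 29;
  caseA_p_mono : nondecr p;
  caseA_q_mono : nondecr q;
  caseA_p_growth : forall n, 0 < n -> p n.+1 >= p n + q n + 1;
  caseA_q_growth : forall n, 0 < n -> q n.+1 >= p n.+1 + q n + 1;
  (* (q m - p m) / 2 >= f (L m.+1) *)
  caseA_gap : forall m, 2 <= m -> q m >= p m + 2 * f (L m.+1) }.

Record caseB (L p q f : nat -> nat) (M k T : nat) : Prop := CaseB {
  caseB_f_pos : pos_valued f;
  caseB_f_unb : unbounded f;
  caseB_f_mono : nondecr f;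
  caseB_M : 2 <= M;
  caseB_fM : forall n, 0 < n -> f (M * n) >= M * f n;
  caseB_k : 1 <= k;
  caseB_Mk : M ^ k >= 9;
  caseB_T : T >= M ^ k;
  caseB_T_growth : forall m, 0 < m -> T ^ m.+1 >= 64 * T ^ m + 29;
  caseB_L : forall m, 0 < m -> L m = (T ^ m);
  caseB_p : forall m, 2 <= m -> p m = f (T ^ m.+1);
  caseB_q : forall m, 2 <= m -> q m = (3 * f (T ^ m.+1)) }.

Record caseC (L p q f : nat -> nat) (M k T : nat) : Prop := CaseC {
  caseC_f_pos : pos_valued f;
  caseC_f_surj : surj_pos f;
  caseC_f_unb : unbounded f;
  caseC_f_mono : nondecr f;
  caseC_M : 2 <= M;
  caseC_fM : forall n, 0 < n -> f (M * n) <= M * f n;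
  caseC_k : 1 <= k;
  caseC_Mk : M ^ k >= 93;
  caseC_T : T >= (M + 1) ^ k;
  caseC_T9 : T >= 9;
  caseC_L : forall m, 0 < m -> is_min_preim f (T ^ m) (L m);
  caseC_p : forall m, 2 <= m -> p m = (T ^ m);
  caseC_q : forall m, 2 <= m -> q m = (3 * T ^ m) }.

(* Main.v *)
From HB Require Import structures.
Require Import Defs.
From mathcomp Require Import all_boot all_order all_algebra all_fingroup center cyclic.
From mathcomp Require Import boolp classical_sets cardinality.
From mathcomp Require Import zify.

(** Shifting [ghat] by [q n] and [hhat] by [p n] makes the supports of the two
    elements meet at [p n + q n], where their values are [gbar n] and [hbar n],
    which do not commute. A finite quotient does not see an additional shift of
    the second element by a multiple [c] of its order. After such a shift with
    [c > q n], a common summand [i] at a common point of the supports would give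
    [q i - p i = q n - p n - c < 0], contradicting [p <= q]; hence the shifted
    elements commute, and the commutator of the original ones dies in every
    finite quotient. *)

Import GRing.Theory.

(** [scatter_at] asks for this form of injectivity; it is confined to [Npos] because [r 0] is
    arbitrary. *)
Lemma npos_incr_inj {r : nat -> nat} :
  (forall n, 0 < n -> r n < r n.+1) -> injective (fun n : Npos => r (val n)).
Proof.
move=> r_incr [i i_gt0] [j j_gt0] /= eq_r; apply: val_inj => /=.
have ltr a b : 0 < a -> a < b -> r a < r b.
  move=> a_gt0; elim: b => // b IHb; rewrite ltnS leq_eqVlt.
  case/predU1P=> [<-|lt_ab]; first exact: r_incr.
  by apply: ltn_trans (IHb lt_ab) (r_incr _ _); lia.
case: (ltngtP i j) => // lt_ij.
  by have := ltr _ _ i_gt0 lt_ij; rewrite eq_r ltnn.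
by have := ltr _ _ j_gt0 lt_ij; rewrite eq_r ltnn.
Qed.

(** The successor allows for [r 1 = 0]; from there on each step gains at least one. *)
Lemma incr_ge_id {r : nat -> nat} n :
  (forall n, 0 < n -> r n < r n.+1) -> 0 < n -> n <= (r n).+1.
Proof.
move=> r_incr; elim: n => // -[//|n] IHn _.
by have := r_incr n.+1 isT; have := IHn isT; lia.
Qed.

(** Isolates what the three choices have in common, so that the rest of the argument treats them at
    once. *)
Lemma choice_incr {L p q : nat -> nat} : p 1 = 0 -> q 1 = 0 ->
  (exists f : nat -> nat, caseA L p q f) \/
  (exists (f : nat -> nat) (M k T : nat), caseB L p q f M k T) \/
  (exists (f : nat -> nat) (M k T : nat), caseC L p q f M k T) ->
  [/\ forall n, 0 < n -> p n < p n.+1, forall n, 0 < n -> q n < q n.+1,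
      forall n, 0 < n -> p n <= q n & forall n, 0 < n -> L n < L n.+1].
Proof.
move=> p1 q1 [[f [f_pos _ _ _ L_incr _ _ p_incr q_incr _]]|[]].
- split=> n n_gt0.
  + by have := p_incr n n_gt0; lia.
  + by have := q_incr n n_gt0; lia.
  + case: n n_gt0 => [//|[_|n _]]; first by rewrite p1.
    by have := q_incr n.+1; lia.
  + by have := L_incr n n_gt0; lia.
- move=> [f [M [k [T [f_pos _ f_mono M_ge2 fM k_gt0 Mk T_ge T_incr LE pE qE]]]]].
  have T_gt0 : 0 < T by lia.
  have leMT : M <= T by apply: leq_trans T_ge; rewrite -{1}(expn1 M) leq_exp2l.
  (* Here [f (T ^ m) < M * f (T ^ m) <= f (M * T ^ m) <= f (T ^ m.+1)]: the first step uses [M >= 2]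
     and the positivity of [f], the last [M <= T]. *)
  have f_incr m : f (T ^ m) < f (T ^ m.+1).
    have Tm : 0 < T ^ m by rewrite expn_gt0 T_gt0.
    have fTm := f_pos _ Tm.
    have := f_mono (M * T ^ m) (T ^ m.+1); rewrite expnS leq_mul2r leMT orbT.
    by have := fM _ Tm; nia.
  split=> n n_gt0.
  (* The formulas for [p] and [q] start at 2, so the passage from 1 to 2 is treated apart: it goes
     from 0 to a positive value. *)
  + case: n n_gt0 => [//|[_|n _]]; last by rewrite !pE.
    by rewrite p1 pE // f_pos // expn_gt0 T_gt0.
  + case: n n_gt0 => [//|[_|n _]]; last by rewrite !qE // ltn_pmul2l.
    by rewrite q1 qE // muln_gt0 f_pos // expn_gt0 T_gt0.
  + case: n n_gt0 => [//|[_|n _]]; first by rewrite p1.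
    by rewrite pE ?qE // leq_pmull.
  + by rewrite !LE //; have := T_incr n n_gt0; lia.
move=> [f [M [k [T [_ _ _ f_mono _ _ _ _ _ T9 LE pE qE]]]]].
have T_gt0 : 0 < T by lia.
have T_incr m : T ^ m < T ^ m.+1 by rewrite ltn_exp2l; lia.
split=> n n_gt0.
- case: n n_gt0 => [//|[_|n _]]; last by rewrite !pE.
  by rewrite p1 pE // expn_gt0 T_gt0.
- case: n n_gt0 => [//|[_|n _]]; last by rewrite !qE // ltn_pmul2l.
  by rewrite q1 qE // muln_gt0 expn_gt0 T_gt0.
- case: n n_gt0 => [//|[_|n _]]; first by rewrite p1.
  by rewrite pE ?qE // leq_pmull.
(* If [L n.+1 <= L n], applying the nondecreasing [f] would give [T ^ n.+1 <= T ^ n]. *)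
rewrite ltnNge; apply/negP => leL.
have [[L1 fL1 _] [L2 fL2 _]] := (LE _ n_gt0, LE n.+1 isT).
by have := f_mono _ _ L2 leL; rewrite fL1 fL2 leqNgt T_incr.
Qed.

Local Open Scope group_scope.

(** A multiplicative map between groups fixes 1 by cancellation. Recording this in the morphism
    structure gives access to the rules for inverses, powers and commutators. *)
Lemma residually_finite_umagma {G : groupType} {x : G} :
  residually_finite G -> x <> 1 ->
  exists (Q : finGroupType) (phi : UMagmaMorphism.type G Q), phi x <> 1.
Proof.
move=> /[apply] -[Q [phi phix]].
have phi1 : phi 1 = 1 by apply: (mulgI (phi 1)); rewrite -gmulfM !mulg1.
pose phiU := Multiplicative_isUMagmaMorphism.Build G Q phi phi1.
pose psi : UMagmaMorphism.type G Q := HB.pack (phi : G -> Q) phi phiU.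
by exists Q, psi.
Qed.

(** The finite quotient dictates [k], while [m] remains free, so the shift can be made as large as
    desired. *)
Lemma commute_residually_finite {G : groupType} {u v : G} (t : G) :
  residually_finite G ->
  (forall k, 0 < k -> exists m, commute u (t ^+ (k * m) * v * t ^- (k * m))) ->
  commute u v.
Proof.
move=> rfG shift_comm; apply: contrapT => ncuv.
have /(residually_finite_umagma rfG)[Q [phi]] : [~ u, v] <> 1.
  by move/eqP=> /commgP.
apply; apply/eqP; rewrite gmulfR; apply/commgP.
(* With [k] the order of [Q], Lagrange's theorem sends [t ^+ (k * m)] to 1, so [phi u] commutes with
   [phi v] itself. *)
have [|m] := shift_comm #|[set: Q]|; first exact: cardG_gt0.
have phit : phi (t ^+ (#|[set: Q]| * m)) = 1.
  by rewrite gmulfXn expgM expg_cardG ?inE ?expg1n.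
move=> /(congr1 phi); rewrite !gmulfM gmulfV /= phit invg1 mul1g mulg1.
exact.
Qed.

Lemma dsum_inM {I : choiceType} {G : I -> groupType} (i : I) (x y : G i) :
  dsum_in x * dsum_in y = dsum_in (x * y).
Proof.
apply: val_inj; apply: functional_extensionality_dep => k.
rewrite -[LHS]/(dfwith _ _ _ * dfwith _ _ _) -[RHS]/(dfwith _ _ _).
have [<-|neq_ik] := eqVneq i k; first by rewrite !dfwith_in.
by rewrite !(dfwith_out _ _ neq_ik) mulg1.
Qed.

Lemma dsum_in_inj {I : choiceType} {G : I -> groupType} (i : I) :
  injective (@dsum_in I G i).
Proof. by move=> x y /(congr1 (fun z => val z i)); rewrite /= !dfwith_in. Qed.

(** At every coordinate at least one of the two elements is trivial. *)
Lemma commute_dsum_in {I : choiceType} {G : I -> groupType} {i j : I}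
    (x : G i) (y : G j) : i != j -> commute (dsum_in x) (dsum_in y).
Proof.
move=> neq_ij; apply: val_inj; apply: functional_extensionality_dep => k.
rewrite -[LHS]/(dfwith _ _ _ * dfwith _ _ _).
rewrite -[RHS]/(dfwith _ _ _ * dfwith _ _ _).
have [eq_ik|neq_ik] := eqVneq i k; last first.
  by rewrite (dfwith_out _ _ neq_ik) mul1g mulg1.
by rewrite (@dfwith_out _ _ _ j) ?mul1g ?mulg1 // -eq_ik eq_sym.
Qed.

Lemma scatter_cases {L r : nat -> nat}
    (g : forall n : Npos, PSL2_power L (val n)) (m : int) :
  scatter r g m = 1 \/
  exists2 n : Npos, Posz (r (val n)) = m & scatter r g m = in_summand (g n).
Proof.
rewrite /scatter; case: pselect => [ex_n|_]; last by left.
by case: (cid ex_n) => n rn /=; right; exists n.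
Qed.

Lemma commute_scatter {L p q : nat -> nat}
    {g h : forall n : Npos, PSL2_power L (val n)} {a b : int} :
  (forall i : Npos, Posz (p (val i)) = a -> Posz (q (val i)) <> b) ->
  commute (scatter p g a) (scatter q h b).
Proof.
move=> disj; have [->|[i pi ->]] := scatter_cases (r := p) g a.
  exact/commute_sym/commute1.
have [->|[j qj ->]] := scatter_cases (r := q) h b; first exact: commute1.
apply: commute_dsum_in; apply/eqP => eq_ij.
by apply: disj pi _; rewrite eq_ij.
Qed.

Lemma wr_baseM {G : groupType} (f1 f2 : int -> G) :
  wr_base f1 * wr_base f2 = wr_base (fun m => f1 m * f2 m).
Proof. by congr Wreath; apply/funext => m; rewrite /shift /= subr0. Qed.

Lemma wr_base_commute {G : groupType} (f1 f2 : int -> G) :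
  commute (wr_base f1) (wr_base f2) <-> forall m, commute (f1 m) (f2 m).
Proof.
rewrite /commute !wr_baseM; split=> [[+] m|cf]; last by congr wr_base; apply/funext.
by move=> /(congr1 (@^~ m)).
Qed.

(** The commutator word [a b a^-1 b^-1], of length 4. *)
Definition F2_comm : F2 :=
  exist _ [:: (false, false); (true, false); (false, true); (true, true)] isT.

Lemma F2_eval_comm {G : groupType} {g h : G} :
  commute g h -> F2_eval F2_comm g h = 1.
Proof.
move=> cgh; rewrite /F2_eval /F2_comm !big_cons big_nil /= /letter_eval /=.
by rewrite mulg1 !mulgA cgh mulgK mulgV.
Qed.

(** The bound on [L] puts the commutator word in [W], since [3 * 4 <= 3 * L n < prime_of L n - 1];
    commuting elements would kill that word. *)
Lemma not_commute_bar {L : nat -> nat} {n : Npos} {g h : PSL2_power L (val n)} :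
  4 <= L (val n) -> (forall w : W L (val n), F2_eval (val w) g h <> 1) ->
  ~ commute g h.
Proof.
move=> L4 free_gh cgh.
have F2_commW : (F2_comm != F2_one) &&
    (3 * F2_length F2_comm < prime_of L (val n) - 1).
  rewrite -val_eqE /= /prime_of; case: ex_minnP => r /andP[_ ltr] _.
  by apply: leq_ltn_trans ltr; rewrite leq_mul.
exact: (free_gh (exist _ F2_comm F2_commW) (F2_eval_comm cgh)).
Qed.

Lemma not_residually_finite_Gamma {L p q : nat -> nat}
    {g h : forall n : Npos, PSL2_power L (val n)} (n : Npos) :
  injective (fun k : Npos => p (val k)) ->
  injective (fun k : Npos => q (val k)) ->
  (forall k, 0 < k -> p k <= q k) ->
  ~ commute (g n) (h n) ->
  ~ residually_finite (Gamma p q g h).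
Proof.
move=> p_inj q_inj le_pq nc_gh rfG.
set S := [set wr_base (scatter p g); wr_base (scatter q h); wr_t (Delta L)]%classic.
have S_gen x : S x -> x \in gen S by move=> Sx; rewrite inE => A [_]; apply.
pose mk x (Sx : S x) : Gamma p q g h :=
  exist (fun y => y \in gen S) x (S_gen x Sx).
have gS : S (wr_base (scatter p g)) by left; left.
have hS : S (wr_base (scatter q h)) by left; right.
have tS : S (wr_t (Delta L)) by right.
pose G := mk _ gS; pose H := mk _ hS; pose T := mk _ tS.
have valM (X Y : Gamma p q g h) : val (X * Y) = val X * val Y by [].
have valV (X : Gamma p q g h) : val (X^-1) = (val X)^-1 by [].
have valX (X : Gamma p q g h) k : val (X ^+ k) = val X ^+ k.
  by elim: k => // k IHk; rewrite !expgS valM IHk.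
have valT k (X : Gamma p q g h) :
    val (T ^+ k * X * T ^- k) = wr_t _ ^+ k * val X * wr_t _ ^- k.
  by rewrite !valM valV valX.
pose a := p (val n); pose b := q (val n).
(* Commutation is read off in the wreath product, where conjugation by powers of [t] shifts
   functions and products are pointwise. *)
have commE c : commute (T ^+ b * G * T ^- b) (T ^+ c * H * T ^- c) <->
    forall m : int,
      commute (scatter p g (m - Posz b)%R) (scatter q h (m - Posz c)%R).
  rewrite -(wr_base_commute (shift _ _) (shift _ _)) -!wr_shift.
  rewrite -[wr_base (scatter p g)]/(val G) -[wr_base (scatter q h)]/(val H) -!valT.
  split=> [cGH|cGH]; last by apply: val_inj; rewrite !valM.
  by rewrite /commute -!valM cGH.
have /commE/(_ (Posz (a + b))) : commute (T ^+ b * G * T ^- b) (T ^+ a * H * T ^- a).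
  (* As [k > 0], the extra shift [k * b.+1] exceeds [b]. A common index [i] would then satisfy
     [q i - p i = b - a - k * b.+1 < 0]. *)
  apply: (commute_residually_finite T rfG) => k k_gt0; exists b.+1.
  have -> : T ^+ (k * b.+1) * (T ^+ a * H * T ^- a) * T ^- (k * b.+1) =
            T ^+ (k * b.+1 + a) * H * T ^- (k * b.+1 + a).
    by rewrite expgnDr invgM !mulgA.
  apply/commE => m; apply: commute_scatter => i pi qi.
  have le_i := le_pq (val i) (valP i); have le_n := le_pq (val n) (valP n).
  nia.
have -> : (Posz (a + b) - Posz b = p (val n))%R by rewrite PoszD addrK.
have -> : (Posz (a + b) - Posz a = q (val n))%R by rewrite addnC PoszD addrK.
rewrite !scatter_at // /commute /in_summand !dsum_inM => /dsum_in_inj.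
exact: nc_gh.
Qed.

Theorem proposition1p5 (L p q : nat -> nat)
    (L_pos : pos_valued L) (p1 : p 1%N = 0%N) (q1 : q 1%N = 0%N)
    (choice_Lpq :
      (exists f : nat -> nat, caseA L p q f) \/
      (exists (f : nat -> nat) (M k T : nat), caseB L p q f M k T) \/
      (exists (f : nat -> nat) (M k T : nat), caseC L p q f M k T))
    (gbar hbar : forall n : Npos, PSL2_power L (val n))
    (gbar_hbar : forall (n : Npos) (w : W L (val n)),
      F2_eval (val w) (gbar n) (hbar n) <> 1%g) :
  ~ residually_finite (Gamma p q gbar hbar).
Proof.
have [p_incr q_incr le_pq L_incr] := choice_incr p1 q1 choice_Lpq.
(* At index 5, [incr_ge_id] yields [5 <= (L 5).+1], enough room for the commutator word. *)
pose n : Npos := exist _ 5 isT.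
have L4 : 4 <= L (val n) by have := incr_ge_id 5 L_incr isT.
apply: (not_residually_finite_Gamma n _ _ le_pq).
- exact: npos_incr_inj p_incr.
- exact: npos_incr_inj q_incr.
exact: not_commute_bar L4 (gbar_hbar n).
Qed.
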